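(* Let $D$ be the formal derivative with respect to the grammar $G\colon x\to xy,\ y\to xz,\ z\to zw,\ w\to xz$. Then $$\mathrm{Gen}(y,t)=\frac{d}{dt}\ln\big(\mathrm{Gen}(z,t)\big)-w+y.$$
   Context: Let $x,y,z,w$ be commuting variables. The formal derivative $D$ is the linear operator on Laurent polynomials in $x,y,z,w$ with $D(uv)=uD(v)+vD(u)$, $D(c)=0$ for constants $c$, and $D(x)=xy$, $D(y)=xz$, $D(z)=zw$, $D(w)=xz$; $D^0$ is the identity. For a Laurent polynomial $u$, $\mathrm{Gen}(u,t)=\sum_{n\ge0}D^n(u)t^n/n!$, a formal power series in $t$. *)

(* Defs.v *)
From HB Require Import structures.
From mathcomp Require Import all_boot all_order all_algebra finmap.
From mathcomp.classical Require Import boolp.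
From mathcomp.multinomials Require Import monalg.

Set Implicit Arguments.
Unset Strict Implicit.
Unset Printing Implicit Defensive.

Import GRing.Theory.
Local Open Scope ring_scope.

Lemma malgUE (I : choiceType) (R : nzRingType) (k : I) (c : R) :
  mkmalgU k c = c *: mkmalgU k 1.
Proof.
by apply/malgP => l; rewrite mcoeffZ !mcoeffU mulrnAr mulr1.
Qed.

(* Laurent polynomials in n variables over K: the group algebra K[Z^n], i.e.
   the finitely supported functions from exponent vectors to coefficients.
   monalg's own product is unavailable, as it requires a monoid of exponents
   without nontrivial units; only its additive and linear layers are reused. *)
Definition laurent (n : nat) (K : fieldType) : Type := {malg K['rV[int]_n]}.

HB.instance Definition _ n (K : fieldType) := GRing.Lmodule.on (laurent n K).

HB.lock Definition lmonom (n : nat) (K : fieldType) (a : 'rV[int]_n) :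
  laurent n K := mkmalgU a 1.
Canonical lmonom_unlockable := Unlockable lmonom.unlock.
Arguments lmonom {n K} a.

(* The linear map determined by its values phi on the monomials. *)
HB.lock Definition lextend (n : nat) (K : fieldType) (V : lmodType K)
  (phi : 'rV[int]_n -> V) (f : laurent n K) : V :=
  \sum_(a <- msupp f) f@_a *: phi a.
Canonical lextend_unlockable := Unlockable lextend.unlock.
Arguments lextend {n K V} phi f.

HB.lock Definition lmul (n : nat) (K : fieldType) (f g : laurent n K) :
  laurent n K := lextend (fun a => lextend (fun b => lmonom (a + b)) g) f.
Canonical lmul_unlockable := Unlockable lmul.unlock.
Arguments lmul {n K} f g.

Section LaurentRing.
Context {n : nat} {K : fieldType}.
Implicit Types (f g h : laurent n K) (a b : 'rV[int]_n).

Lemma lextendEw (V : lmodType K) (phi : 'rV[int]_n -> V) f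
    (s : {fset 'rV[int]_n}) : (msupp f `<=` s)%fset ->
  lextend phi f = \sum_(a <- s) f@_a *: phi a.
Proof.
move=> fs; rewrite unlock; apply: big_fset_incl => // a _ /mcoeff_outdom ->.
by rewrite scale0r.
Qed.

Lemma lextend_is_linear (V : lmodType K) (phi : 'rV[int]_n -> V) :
  linear (lextend phi).
Proof.
move=> c f g.
pose s := (msupp f `|` msupp g)%fset.
rewrite (@lextendEw _ _ f s) ?fsubsetUl // (@lextendEw _ _ g s) ?fsubsetUr //.
rewrite (@lextendEw _ _ _ s); last first.
  apply: fsubset_trans (msuppD_le _ _) _.
  exact: fsetUSS (msuppZ_le _ _) (fsubset_refl _).
rewrite scaler_sumr -big_split; apply: eq_bigr => a _ /=.
by rewrite mcoeffD mcoeffZ scalerDl scalerA.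
Qed.

HB.instance Definition _ (V : lmodType K) (phi : 'rV[int]_n -> V) :=
  GRing.isLinear.Build K (laurent n K) V _ (lextend phi)
    (lextend_is_linear phi).

Lemma lextendE (V : lmodType K) (phi : 'rV[int]_n -> V) a :
  lextend phi (lmonom a) = phi a.
Proof.
rewrite lmonom.unlock (@lextendEw _ _ _ [fset a]%fset) ?msuppU_le //.
by rewrite big_seq_fset1 mcoeffUU scale1r.
Qed.

Lemma laurentE f : f = \sum_(a <- msupp f) f@_a *: lmonom a.
Proof.
rewrite {1}[f]monalgE; apply: eq_bigr => a _.
by rewrite lmonom.unlock; apply: malgUE.
Qed.

Lemma laurent_ind (P : laurent n K -> Prop) :
  (forall c f g, P f -> P g -> P (c *: f + g)) -> P 0 ->
  (forall a, P (lmonom a)) -> forall f, P f.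
Proof.
move=> Plin P0 Pm f; rewrite [f]laurentE.
by elim/big_rec: _ => // a g _ Pg; apply: Plin.
Qed.

Lemma lmul_linl g : linear (lmul^~ g).
Proof. by move=> c f h; rewrite !lmul.unlock linearP. Qed.

Lemma lmul_linr f : linear (lmul f).
Proof.
move=> c g h; rewrite !lmul.unlock !(@lextendEw _ _ f (msupp f)) //.
rewrite scaler_sumr -big_split; apply: eq_bigr => a _ /=.
by rewrite linearP /= scalerDr !scalerA mulrC.
Qed.

Lemma lmul0l g : lmul 0 g = 0.
Proof. by rewrite lmul.unlock linear0. Qed.

Lemma lmul_monom a b : lmul (lmonom a) (lmonom b) = lmonom (a + b) :> laurent n K.
Proof. by rewrite lmul.unlock !lextendE. Qed.

Lemma lmulC : commutative (@lmul n K).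
Proof.
have lmul0r f : lmul f 0 = 0.
  by have := lmul_linr f (-1) 0 0; rewrite scaler0 addr0 scaleN1r addNr.
move=> f g; elim/laurent_ind: f => [c f h IHf IHh||a].
- by rewrite lmul_linl lmul_linr IHf IHh.
- by rewrite lmul0l lmul0r.
elim/laurent_ind: g => [c f h IHf IHh||b].
- by rewrite lmul_linl lmul_linr IHf IHh.
- by rewrite lmul0l lmul0r.
by rewrite !lmul_monom addrC.
Qed.

Lemma lmul0r f : lmul f 0 = 0.
Proof. by rewrite lmulC lmul0l. Qed.

Lemma lmulA : associative (@lmul n K).
Proof.
move=> f g h; elim/laurent_ind: f => [c f1 f2 IH1 IH2||a].
- by rewrite !lmul_linl IH1 IH2.
- by rewrite !lmul0l.
elim/laurent_ind: g => [c f1 f2 IH1 IH2||b].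
- by rewrite lmul_linl !lmul_linr lmul_linl IH1 IH2.
- by rewrite !(lmul0l, lmul0r).
elim/laurent_ind: h => [c f1 f2 IH1 IH2||d].
- by rewrite !lmul_linr IH1 IH2.
- by rewrite !lmul0r.
by rewrite !lmul_monom addrA.
Qed.

Lemma lmul1l : left_id (lmonom 0 : laurent n K) lmul.
Proof.
move=> f; elim/laurent_ind: f => [c f1 f2 IH1 IH2||d].
- by rewrite lmul_linr IH1 IH2.
- by rewrite lmul0r.
by rewrite lmul_monom add0r.
Qed.

Lemma lmulDl : left_distributive (@lmul n K) +%R.
Proof. by move=> f g h; have := lmul_linl h 1 f g; rewrite !scale1r. Qed.

Lemma lmonom0_neq0 : lmonom 0 != 0 :> laurent n K.
Proof. by rewrite lmonom.unlock monalgU_eq0 oner_eq0. Qed.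

HB.instance Definition _ := GRing.Zmodule_isComNzRing.Build (laurent n K)
  lmulA lmulC lmul1l lmulDl lmonom0_neq0.

Lemma lscaleAl c f g : c *: (f * g) = (c *: f) * g.
Proof.
by rewrite /GRing.mul /= lmul.unlock linearZ.
Qed.

HB.instance Definition _ :=
  GRing.Lmodule_isLalgebra.Build K (laurent n K) lscaleAl.
HB.instance Definition _ :=
  GRing.Lalgebra_isComAlgebra.Build K (laurent n K).

(* The inverse is chosen classically; it is the identity on nonunits. *)
Definition lunit : pred (laurent n K) := fun f => `[< exists g, g * f = 1 >].

Definition linv f : laurent n K :=
  if pselect (exists g, g * f = 1) is left ex then projT1 (cid ex) else f.

Lemma lmulV : {in lunit, left_inverse 1 linv *%R}.
Proof.
move=> f /asboolP fU; rewrite /linv.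
by case: pselect => // ex; case: (cid ex).
Qed.

Lemma lunitP f g : g * f = 1 -> lunit f.
Proof. by move=> gf; apply/asboolP; exists g. Qed.

Lemma linv_out : {in [predC lunit], linv =1 id}.
Proof.
move=> f /negP nU; rewrite /linv; case: pselect => // -[g gf].
by case: nU; exact: lunitP gf.
Qed.

HB.instance Definition _ := GRing.ComNzRing_hasMulInverse.Build (laurent n K)
  lmulV lunitP linv_out.

Lemma lmonomM a b : lmonom a * lmonom b = lmonom (a + b) :> laurent n K.
Proof. exact: lmul_monom. Qed.

Lemma lmonom0 : lmonom 0 = 1 :> laurent n K.
Proof. by []. Qed.

Lemma lmonom_unit a : (lmonom a : laurent n K) \is a GRing.unit.
Proof. by apply: (@lunitP _ (lmonom (- a))); rewrite lmonomM addNr. Qed.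

Definition lvar (i : 'I_n) : laurent n K := lmonom (delta_mx 0 i).

End LaurentRing.

Arguments lvar {n} K i.

HB.instance Definition _ n (K : fieldType) :=
  GRing.ComUnitAlgebra.on (laurent n K).

(* Formal power series over A; [f k] is the coefficient of t^k in f. *)
Definition fps (A : Type) : Type := nat -> A.

Section FpsRing.
Context {A : comNzRingType}.
Implicit Types f g h : fps A.

HB.instance Definition _ := gen_eqMixin (fps A).
HB.instance Definition _ := gen_choiceMixin (fps A).

Definition fps_const (a : A) : fps A := fun k => if k is 0%N then a else 0.
Definition fps_add f g : fps A := fun k => f k + g k.
Definition fps_opp f : fps A := fun k => - f k.
Definition fps_mul f g : fps A := fun k => \sum_(i < k.+1) f i * g (k - i)%N.

Lemma fps_addA : associative fps_add.
Proof. by move=> f g h; apply: funext => k; apply: addrA. Qed.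
Lemma fps_addC : commutative fps_add.
Proof. by move=> f g; apply: funext => k; apply: addrC. Qed.
Lemma fps_add0 : left_id (fps_const 0) fps_add.
Proof. by move=> f; apply: funext => -[|k]; apply: add0r. Qed.
Lemma fps_addN : left_inverse (fps_const 0) fps_opp fps_add.
Proof. by move=> f; apply: funext => -[|k]; apply: addNr. Qed.

HB.instance Definition _ := GRing.isZmodule.Build (fps A)
  fps_addA fps_addC fps_add0 fps_addN.

Lemma fps_mulE f g m k : (k < m)%N ->
  fps_mul f g k = ((\poly_(i < m) f i) * (\poly_(i < m) g i))`_k.
Proof.
move=> km; rewrite coefM; apply: eq_bigr => i _.
rewrite !coef_poly (leq_ltn_trans (leq_subr _ _) km).
by rewrite (leq_trans (ltn_ord i) km).
Qed.

Lemma fps_mulC : commutative fps_mul.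
Proof.
by move=> f g; apply: funext => k; rewrite !(@fps_mulE _ _ k.+1) // mulrC.
Qed.

Lemma fps_mulA : associative fps_mul.
Proof.
move=> f g h; apply: funext => k.
pose P (u : fps A) := \poly_(i < k.+1) u i.
have -> : fps_mul f (fps_mul g h) k = (P f * (P g * P h))`_k.
  rewrite coefM; apply: eq_bigr => i _.
  rewrite coef_poly ltn_ord; congr (_ * _).
  by apply: fps_mulE; rewrite ltnS leq_subr.
rewrite mulrA coefM; apply: eq_bigr => i _.
rewrite coef_poly ltnS leq_subr; congr (_ * _).
by rewrite (@fps_mulE _ _ k.+1).
Qed.

Lemma fps_mul1 : left_id (fps_const 1) fps_mul.
Proof.
move=> f; apply: funext => k; rewrite /fps_mul big_ord_recl /= mul1r subn0.
by rewrite big1 ?addr0 // => i _; rewrite mul0r.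
Qed.

Lemma fps_mulDl : left_distributive fps_mul fps_add.
Proof.
move=> f g h; apply: funext => k; rewrite /fps_mul /fps_add -big_split.
by apply: eq_bigr => i _; rewrite mulrDl.
Qed.

Lemma fps_one_neq0 : fps_const 1 != 0.
Proof. by apply/eqP => /(congr1 (fun f : fps A => f 0%N)) /eqP; rewrite oner_eq0. Qed.

HB.instance Definition _ := GRing.Zmodule_isComNzRing.Build (fps A)
  fps_mulA fps_mulC fps_mul1 fps_mulDl fps_one_neq0.

Definition fps_deriv f : fps A := fun k => f k.+1 *+ k.+1.

End FpsRing.

Definition fps_map (A B : Type) (phi : A -> B) (f : fps A) : fps B :=
  fun k => phi (f k).

Section FpsLog.
Context {K : fieldType} {A : comUnitAlgType K}.

(* ln (1 + u) = \sum_(k >= 1) (-1)^(k-1) u^k / k, for u without constant term;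
   then u^k has order at least k, so only k <= m contribute to t^m. *)
Definition fps_log1p (u : fps A) : fps A := fun m =>
  \sum_(1 <= k < m.+1) ((-1) ^+ k.-1 / k%:R : K) *: (u ^+ k) m.

(* ln f = ln f_0 + ln (f / f_0), for f whose constant term f_0 is a unit of A.
   In general A contains no logarithm of f_0, which is therefore adjoined as
   an indeterminate: ln f has coefficients in A[ln f_0] = {poly A}, and 'X
   stands for ln f_0. *)
Definition fps_ln (f : fps A) : fps {poly A} :=
  fps_const 'X + fps_map polyC (fps_log1p (fps_const (f 0%N)^-1 * f - 1)).

End FpsLog.

Section Grammar.
Context {K : fieldType}.

Definition varx : laurent 4 K := lvar K (inord 0).
Definition vary : laurent 4 K := lvar K (inord 1).
Definition varz : laurent 4 K := lvar K (inord 2).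
Definition varw : laurent 4 K := lvar K (inord 3).

Definition grammar_derivative (D : {linear laurent 4 K -> laurent 4 K}) : Prop :=
  [/\ forall u v, D (u * v) = u * D v + v * D u,
      forall c : K, D c%:A = 0 &
      [/\ D varx = varx * vary, D vary = varx * varz,
          D varz = varz * varw & D varw = varx * varz]].

Definition Gen (D : laurent 4 K -> laurent 4 K) (u : laurent 4 K) :
  fps (laurent 4 K) := fun k => (k`!%:R : K)^-1 *: iter k D u.

End Grammar.

Arguments varx : clear implicits.
Arguments vary : clear implicits.
Arguments varz : clear implicits.
Arguments varw : clear implicits.

Section Existence.
Context {n : nat} {K : fieldType} (rule : 'I_n -> laurent n K).

Definition lderive_monom (a : 'rV[int]_n) : laurent n K :=
  \sum_i ((a 0 i)%:~R : K) *: (lmonom (a - delta_mx 0 i) * rule i).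

Definition lderive : laurent n K -> laurent n K := lextend lderive_monom.

HB.instance Definition _ := GRing.Linear.on lderive.

Lemma lderiveM (u v : laurent n K) :
  lderive (u * v) = u * lderive v + v * lderive u.
Proof.
elim/(@laurent_ind n K): u => [c f1 f2 IH1 IH2||a].
- rewrite mulrDl -scalerAl !linearP /= IH1 IH2 mulrDl mulrDr.
  by rewrite -scalerAl -scalerAr scalerDr addrACA.
- by rewrite mul0r linear0 mul0r mulr0 addr0.
elim/(@laurent_ind n K): v => [c f1 f2 IH1 IH2||b].
- rewrite mulrDr -scalerAr !linearP /= IH1 IH2 mulrDl mulrDr.
  by rewrite -scalerAl -scalerAr scalerDr addrACA.
- by rewrite mulr0 linear0 mul0r mulr0 addr0.
rewrite lmonomM /lderive !lextendE /lderive_monom !mulr_sumr -big_split.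
apply: eq_bigr => i _ /=.
rewrite -!scalerAr !mulrA !lmonomM mxE intrD [in RHS]addrC.
by rewrite ![_ + (_ - _)]addrA [b + a]addrC scalerDl.
Qed.

Lemma lderiveX i : lderive (lvar K i) = rule i.
Proof.
rewrite /lderive lextendE /lderive_monom (bigD1 i) //= big1.
  by rewrite mxE !eqxx scale1r subrr lmonom0 mul1r addr0.
by move=> j ji; rewrite mxE (negPf ji) scale0r.
Qed.

Lemma lderive1 : lderive 1 = 0.
Proof.
have := lderiveM 1 1; rewrite !mul1r => /(congr1 (+%R^~ (- lderive 1))).
by rewrite subrr addrK => <-.
Qed.

End Existence.

Lemma grammar_derivative_exists (K : fieldType) :
  exists D, @grammar_derivative K D.
Proof.
pose r (i : 'I_4) : laurent 4 K :=
  tnth [tuple varx K * vary K; varx K * varz K; varz K * varw K;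
              varx K * varz K] i.
exists (lderive r); split; first exact: lderiveM.
  by move=> c; rewrite linearZ /= lderive1 scaler0.
have E i : lderive r (lvar K i) = r i by exact: lderiveX.
by split; rewrite [LHS]E /r (tnth_nth 0) /= inordK.
Qed.

(* Main.v *)
(* As D is a derivation, Gen is multiplicative, and d/dt Gen(u) = Gen(D u).
   So D z = z w gives Gen(z)' = Gen(z) Gen(w), i.e. (ln Gen(z))' = Gen(w), and
   D w = D y makes Gen(w) and Gen(y) differ only in their constant terms. *)
Require Import Defs.
From mathcomp Require Import all_boot all_order all_algebra.
From mathcomp.classical Require Import boolp.

Import GRing.Theory.
Local Open Scope ring_scope.

Section FpsTheory.
Context {A : comNzRingType}.
Implicit Types f g h : fps A.

Lemma fps_coefD f g k : (f + g) k = f k + g k. Proof. by []. Qed.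
Lemma fps_coefN f k : (- f) k = - f k. Proof. by []. Qed.
Lemma fps_coefB f g k : (f - g) k = f k - g k. Proof. by []. Qed.
Lemma fps_coefMn f n k : (f *+ n) k = f k *+ n.
Proof. by elim: n => [|n IHn]; [case: k | rewrite !mulrS fps_coefD IHn]. Qed.
Lemma fps_coefM f g k : (f * g) k = \sum_(i < k.+1) f i * g (k - i)%N.
Proof. by []. Qed.

Lemma fps_coef_sum I (r : seq I) (P : pred I) (F : I -> fps A) k :
  (\sum_(i <- r | P i) F i) k = \sum_(i <- r | P i) F i k.
Proof.
by apply: (big_morph (fun f : fps A => f k)) => [f g|]; last case: k.
Qed.

Lemma fps_constM (a : A) f k : (fps_const a * f) k = a * f k.
Proof.
rewrite fps_coefM big_ord_recl subn0 big1 ?addr0 // => i _.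
by rewrite mul0r.
Qed.

Lemma fps_derivD f g : fps_deriv (f + g) = fps_deriv f + fps_deriv g.
Proof. by apply: funext => k; rewrite /fps_deriv !fps_coefD mulrnDl. Qed.

Lemma fps_deriv_const (a : A) : fps_deriv (fps_const a) = 0.
Proof. by apply: funext => k; rewrite /fps_deriv /= mul0rn; case: k. Qed.

Lemma fps_deriv1 : fps_deriv (1 : fps A) = 0.
Proof. exact: fps_deriv_const. Qed.

Lemma fps_derivM f g :
  fps_deriv (f * g) = fps_deriv f * g + f * fps_deriv g.
Proof.
apply: funext => k; rewrite fps_coefD !fps_coefM /fps_deriv fps_coefM.
(* Each sum is extended by one term with multiplicity 0, at [i = 0] here and at [i = k.+1] below.
   The multiplicities [i] and [k.+1 - i] then add up to [k.+1] termwise. *)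
have -> : \sum_(i < k.+1) (f i.+1 *+ i.+1) * g (k - i)%N =
          \sum_(i < k.+2) (f i *+ i) * g (k.+1 - i)%N.
  by rewrite [RHS]big_ord_recl mulr0n mul0r add0r.
have -> : \sum_(i < k.+1) f i * (g (k - i).+1 *+ (k - i).+1) =
          \sum_(i < k.+2) f i * (g (k.+1 - i)%N *+ (k.+1 - i)).
  rewrite [RHS]big_ord_recr /= subnn mulr0n mulr0 addr0.
  by apply: eq_bigr => i _; rewrite subSn // -ltnS.
rewrite -sumrMnl -big_split; apply: eq_bigr => i _ /=.
by rewrite mulrnAl mulrnAr -mulrnDr subnKC // -ltnS.
Qed.

Lemma fps_derivX f k :
  fps_deriv (f ^+ k.+1) = (f ^+ k * fps_deriv f) *+ k.+1.
Proof.
elim: k => [|k IHk]; first by rewrite expr1 expr0 mul1r.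
by rewrite exprS fps_derivM IHk mulrnAr mulrA -exprS mulrC -mulrS exprS mulrC.
Qed.

Lemma fps_derivMc (a : A) f :
  fps_deriv (fps_const a * f) = fps_const a * fps_deriv f.
Proof. by rewrite fps_derivM fps_deriv_const mul0r add0r. Qed.

Lemma fps_coefX_eq0 f k m : f 0%N = 0 -> (m < k)%N -> (f ^+ k) m = 0.
Proof.
move=> f0; elim: k m => // k IHk m mk; rewrite exprS fps_coefM big1 // => i _.
have [-> | i0] := posnP i; first by rewrite f0 mul0r.
have m0 : (0 < m)%N := leq_trans i0 (ltn_ord i).
rewrite IHk ?mulr0 //; apply: leq_trans (mk : (m <= k)%N).
by rewrite ltn_subrL i0.
Qed.

End FpsTheory.

(** By strong induction on [k]: once the lower coefficients of [g - h] vanish, coefficient [k] of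
    [f * (g - h)] is [f 0 * (g - h) k], and [f 0] cancels. *)
Lemma fps_mulrI {A : comUnitRingType} (f : fps A) :
  f 0%N \is a GRing.unit -> GRing.lreg f.
Proof.
move=> fU g h /(congr1 (+%R^~ (- (f * h)))); rewrite subrr -mulrBr => fgh.
suff e k : (g - h) k = 0.
  by apply: funext => k; apply/eqP; rewrite -subr_eq0 -fps_coefB e.
elim/ltn_ind: k => k IHk; apply: (mulrI fU).
have := congr1 (fun f : fps A => f k) fgh.
rewrite mulr0 fps_coefM big_ord_recl subn0 big1 => [|i _]; last first.
  by rewrite IHk ?mulr0 // ltn_subrL /=; apply: leq_ltn_trans (ltn_ord i).
by rewrite addr0 => ->; case: k {IHk}.
Qed.

Section Log.
Context {K : fieldType} {A : comUnitAlgType K}.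
Context (charK : [pchar K] =i pred0).

Lemma natK_neq0 k : k.+1%:R != 0 :> K.
Proof. by rewrite ((pcharf0P K).1 charK). Qed.

(** The extra terms vanish because [u ^+ k] has order at least [k]. Hence a single bound [N] serves
    all coefficients below [N]. *)
Lemma fps_coef_log1p (u : fps A) m N : u 0%N = 0 -> (m < N)%N ->
  fps_log1p u m =
    \sum_(1 <= k < N) ((-1) ^+ k.-1 / k%:R : K) *: (u ^+ k) m.
Proof.
move=> u0 mN; rewrite /fps_log1p [RHS](big_cat_nat (n := m.+1)) //=.
rewrite [X in _ + X]big_nat [X in _ + X]big1 ?addr0 // => k /andP[mk _].
by rewrite fps_coefX_eq0 // scaler0.
Qed.

(* Up to order N the derivative of ln (1 + u) is u' times the geometric sum
   \sum_(k < N) (- u)^k, and (1 + u) times that sum is 1 - (- u)^N. *)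
Lemma fps_deriv_log1p (u : fps A) : u 0%N = 0 ->
  (1 + u) * fps_deriv (fps_log1p u) = fps_deriv u.
Proof.
move=> u0; apply: funext => m.
have L k : (k <= m)%N -> fps_deriv (fps_log1p u) k =
    ((\sum_(i < m.+1) (- u) ^+ i) * fps_deriv u) k.
  move=> km; rewrite {1}/fps_deriv (@fps_coef_log1p _ _ m.+2) //.
  rewrite big_add1 /= big_mkord mulr_suml fps_coef_sum -sumrMnl.
  apply: eq_bigr => i _; rewrite scalerMnr -/(fps_deriv (u ^+ i.+1) k).
  rewrite fps_derivX [in RHS]exprNn -mulrA.
  rewrite fps_coefMn -(scaler_nat i.+1) scalerA divfK ?natK_neq0 //.
  (* The sign is a scalar of [K] on the left and a power series on the right; only its parity is
     common to both. *)
  rewrite -[X in X *: _]signr_odd -[X in X * (_ ^+ _ * _)]signr_odd.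
  by rewrite scaler_sign mulr_sign; case: (odd i).
rewrite fps_coefM; under eq_bigr => i _ do rewrite L ?leq_subr //.
rewrite -fps_coefM mulrA.
have -> : (1 + u) * (\sum_(i < m.+1) (- u) ^+ i) = 1 - (- u) ^+ m.+1.
  rewrite -[in RHS](expr1n _ m.+1) subrXX opprK; congr (_ * _).
  by apply: eq_bigr => i _; rewrite expr1n mul1r.
rewrite mulrBl mul1r fps_coefB fps_coefM big1 ?subr0 // => i _.
by rewrite fps_coefX_eq0 ?mul0r // fps_coefN u0 oppr0.
Qed.

(** Writing [f / f 0] as [1 + u], both [h] and the derivative of ln (1 + u) give [u'] when
    multiplied by [1 + u], which is cancellable. The adjoined ln [f 0] is constant in t, so no ['X]
    survives. *)
Lemma fps_deriv_ln (f h : fps A) : f 0%N \is a GRing.unit ->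
  fps_deriv f = f * h -> fps_deriv (fps_ln f) = fps_map polyC h.
Proof.
move=> fU fh; rewrite /fps_ln fps_derivD fps_deriv_const add0r.
set u := _ - 1.
have uE : 1 + u = fps_const (f 0%N)^-1 * f by rewrite addrC subrK.
have u0 : u 0%N = 0.
  by rewrite /u fps_coefB fps_constM mulVr // subrr.
have du : fps_deriv u = (1 + u) * h.
  rewrite uE -mulrA -fh -fps_derivMc -uE [in RHS]fps_derivD.
  by rewrite fps_deriv1 add0r.
have lh : fps_deriv (fps_log1p u) = h.
  apply: (@fps_mulrI _ (1 + u)); last by rewrite fps_deriv_log1p.
  by rewrite fps_coefD u0 addr0 unitr1.
by apply: funext => k; rewrite -lh /fps_map /fps_deriv polyCMn.
Qed.

End Log.

(* The analogue of [Gen] over an abstract algebra: with [laurent 4 K] instead,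
   unification unfolds the Laurent ring and does not terminate in practice. *)
Definition egf {K : fieldType} {A : comAlgType K} (D : A -> A) (u : A) :
  fps A := fun k => (k`!%:R : K)^-1 *: iter k D u.

Section Egf.
Context {K : fieldType} (charK : [pchar K] =i pred0).
Context {A : comAlgType K} (D : {linear A -> A}).
Implicit Types u v : A.

Lemma egf0 u : egf D u 0%N = u.
Proof. by rewrite /egf fact0 invr1 scale1r. Qed.

Lemma egfS u k : egf D u k.+1 = (k.+1%:R : K)^-1 *: egf D (D u) k.
Proof. by rewrite /egf iterSr factS natrM invfM scalerA. Qed.

Lemma egfD u v : egf D (u + v) = egf D u + egf D v.
Proof.
apply: funext => k; rewrite fps_coefD /egf -scalerDr; congr (_ *: _).
by elim: k => //= k ->; rewrite linearD.
Qed.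

Lemma fps_deriv_egf u : fps_deriv (egf D u) = egf D (D u).
Proof.
apply: funext => k; rewrite /fps_deriv egfS -scaler_nat scalerA.
by rewrite (divff (natK_neq0 charK k)) scale1r.
Qed.

(** In characteristic 0 this reduces an equality at index [k.+1] to one between derivatives at index
    [k]. *)
Lemma fps_coefS (f : fps A) k : f k.+1 = (k.+1%:R : K)^-1 *: fps_deriv f k.
Proof.
rewrite /fps_deriv -scaler_nat scalerA.
by rewrite (mulVf (natK_neq0 charK k)) scale1r.
Qed.

(** The Leibniz rules of [D] and of d/dt match. The induction on the index keeps [u] and [v]
    general, since the step replaces one of them by its image under [D]. *)
Lemma egfM u v : (forall u v, D (u * v) = u * D v + v * D u) ->
  egf D (u * v) = egf D u * egf D v.
Proof.
move=> DM; apply: funext => k; elim: k u v => [|k IHk] u v.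
  by rewrite fps_coefM big_ord1 !egf0.
rewrite egfS fps_coefS; congr (_ *: _).
rewrite fps_derivM !fps_deriv_egf DM egfD !fps_coefD !IHk addrC.
by rewrite [egf D v * _]mulrC.
Qed.

End Egf.

Theorem theorem3p3 (K : fieldType) (charK : [pchar K] =i pred0)
    (D : {linear laurent 4 K -> laurent 4 K}) (hD : grammar_derivative D) :
  fps_map polyC (Gen D (vary K)) =
    fps_deriv (fps_ln (Gen D (varz K)))
      - fps_const (varw K)%:P + fps_const (vary K)%:P.
Proof.
have [DM _ [_ Dy Dz Dw]] := hD.
have GenE u : Gen D u = egf D u by [].
rewrite !GenE.
rewrite (@fps_deriv_ln _ _ charK _ (egf D (varw K))).
(* Index 0 reads y = w - w + y. At index [k.+1] the constants contribute nothing, and both sides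
   depend only on D y = x z = D w. *)
- apply: funext => -[|k].
    by rewrite fps_coefD fps_coefB /fps_map !egf0 subrr add0r.
  by rewrite fps_coefD fps_coefB /= subr0 addr0 /fps_map !egfS Dy Dw.
(* The constant term of Gen(z) is the monomial z, a unit among Laurent polynomials. *)
- by rewrite egf0 lmonom_unit.
by rewrite fps_deriv_egf // Dz egfM.
Qed.
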